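(* Let $X=\{0,1\}$ and let $d$ be the standard distance on $X^{\omega}$. (i) Let $(X^{\omega},d,\delta)$ be a weak dilatation structure such that $p_{0}=0$. Then there exists a smooth function $$W:\mathbb{N}^{*}\times X^{\omega}\to \mathrm{Isom}(X^{\omega}),\qquad W(n,x)=W^{x}_{n},$$ such that for any $q\in X^{*}$, $\alpha\in X$, $x,y\in X^{\omega}$ we have $$\delta_{2}^{q\alpha x}\, q\bar{\alpha}y \;=\; q\,\alpha\,\overline{x_{1}}\; W^{q\alpha x}_{|q|+1}(y), \qquad (\ast)$$ where $x_1$ is the first letter of $x$. (ii) Conversely, to any smooth function $W:\mathbb{N}^{*}\times X^{\omega}\to \mathrm{Isom}(X^{\omega})$ is associated a weak dilatation structure $(X^{\omega},d,\delta)$ with $p_{0}=0$, induced by the functions $\delta_{2}^{x}$ defined by $\delta_{2}^{x}x=x$ and otherwise by relation $(\ast)$.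
   Context: Words. $X=\{0,1\}$, $\bar 0=1$, $\bar 1=0$; $\mathbb{N}=\{0,1,2,\dots\}$, $\mathbb{N}^{*}=\{1,2,\dots\}$. $X^{*}$ is the set of finite words (including the empty word), $|q|$ is the length of $q\in X^{*}$; $X^{\omega}$ is the set of infinite words $w=w_{1}w_{2}\dots$. Juxtaposition is concatenation. The standard ultrametric is $d(x,y)=2^{-m}$ for $x\neq y$, where $m$ is the length of the longest common prefix of $x,y$, and $d(x,x)=0$; $X^\omega$ is compact of diameter $1$. $\mathrm{Isom}(X^{\omega})$ is the group of isometries of $(X^{\omega},d)$. Dilatations. $\Gamma=\{2^{p}: p\in\mathbb{Z}\}$ is the discrete multiplicative group of powers of $2$ seen as dyadic numbers, with $\nu(2^{p})=2^{-p}$; thus ''$\varepsilon\to 0$'' means $\varepsilon=2^{p}$, $p\to+\infty$. A weak dilatation structure $(X^{\omega},d,\delta)$ consists, for each $x\in X^{\omega}$, of maps $\delta^{x}_{2^{p}}:X^{\omega}\to V_{2^{p}}(x)$ for $p\ge 0$ and $\delta^{x}_{2^{-p}}:W_{2^{-p}}(x)\to X^{\omega}$ for $p\geq 1$, with $V_{2^{p}}(x), W_{2^{-p}}(x)\subset X^{\omega}$ open, satisfying: A0. Each $\delta^{x}_{2^{p}}$, $p\ge 0$, is a homeomorphism, and $\{y: d(x,y)\le 2^{-p}\}\subset \delta^{x}_{2^{p}}X^{\omega}\subset V_{2^{p}}(x)$. For $p\ge1$, $\delta^{x}_{2^{-p}}$ is injective and invertible on its image, $V_{2^{p}}(x)\subset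 W_{2^{-p}}(x)$, and $\delta^{x}_{2^{-p}}\delta^{x}_{2^{p}}u=u$ for all $u$. There are $R>0$, $p_1\in\mathbb{N}$ such that $\delta^{x}_{2^{p}}v\in W_{2^{-p}}(\delta^{x}_{2^{p}}u)$ whenever $d(x,u),d(x,v)\le R$ and $p\ge p_1$. A1. $\delta^{x}_{\varepsilon}x=x$, $\delta^{x}_{1}=\mathrm{id}$; the map $(\varepsilon,x,y)\mapsto\delta^{x}_{\varepsilon}y$ is continuous on its domain $\mathrm{dom}\,\delta\subset\Gamma\times X^{\omega}\times X^{\omega}$, and extends continuously to the closure of $\mathrm{dom}\,\delta$ in $(\Gamma\cup\{0\})\times X^{\omega}\times X^{\omega}$, with $\lim_{p\to\infty}\delta^{x}_{2^{p}}y=x$. A2. $\delta^{x}_{2^{p}}\delta^{x}_{2^{r}}u=\delta^{x}_{2^{p+r}}u$ for all $p,r\ge0$ and $x,u\in X^\omega$. A3. For each $x$ there is a function $d^{x}$ on $X^{\omega}\times X^{\omega}$ with $\lim_{p\to\infty}2^{p}d(\delta^{x}_{2^{p}}u,\delta^{x}_{2^{p}}v)=d^{x}(u,v)$ uniformly in $x,u,v$; moreover $d^{x}$ is non-degenerate: $d^{x}(u,v)=0$ implies $u=v$. The number $p_{0}$ is the smallest natural number such that $2^{p}d(\delta^{x}_{2^{p}}u,\delta^{x}_{2^{p}}v)=d^{x}(u,v)$ for all $x,u,v\in X^{\omega}$ and all $p\ge p_{0}$. So ''$p_{0}=0$'' means that this equality holds for all $p\in\mathbb{N}$. ''Induced by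 the functions $\delta^x_2$'' means that all other dilatations are obtained from those of coefficient $2$ by A2: $\delta^{x}_{2^{p}}=(\delta^{x}_{2})^{p}$ for $p\ge0$, and $\delta^{x}_{2^{-p}}$ is the inverse of $\delta^{x}_{2^{p}}$ on its image. Smoothness. A function $W:\mathbb{N}^{*}\times X^{\omega}\to\mathrm{Isom}(X^{\omega})$ is smooth if for any $\varepsilon>0$ there exists $\mu(\varepsilon)>0$ such that for any $x,x'\in X^{\omega}$ with $d(x,x')<\mu(\varepsilon)$ and any $y\in X^{\omega}$ we have $\frac{1}{2^{k}}d(W^{x}_{k}(y),W^{x'}_{k}(y))\le\varepsilon$ for any $k\in\mathbb{N}^{*}$ such that $d(x,x')<1/2^{k}$. *)

(* Defs.v *)
From HB Require Import structures.
From mathcomp Require Import all_boot all_order all_algebra.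
From mathcomp Require Import all_classical all_reals all_analysis.

Set Implicit Arguments.
Unset Strict Implicit.
Unset Printing Implicit Defensive.

Import Order.TTheory GRing.Theory Num.Theory numFieldNormedType.Exports.

Local Open Scope classical_set_scope.
Local Open Scope ring_scope.

(* X^omega with X = {0,1} = bool; letters are numbered from 0, so the letter
   w_k of an infinite word is [w k.-1]. The parameter R only fixes the field in
   which distances take their values. *)
Definition infword (R : realType) : Type := nat -> bool.

HB.instance Definition _ (R : realType) := Choice.on (infword R).

(* [ex_minn h] is the first position where x and y differ, i.e. the length of
   their longest common prefix. *)
Definition wdist (R : realType) (x y : infword R) : R :=
  if pselect (exists n, x n != y n) is left h then 2 ^- ex_minn h else 0.

Section Metric.
Variable R : realType.
Implicit Types x y z : infword R.

Lemma wdist_le x y n :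
  (wdist x y <= 2 ^- n) <-> (forall k, (k < n)%N -> x k = y k).
Proof.
rewrite /wdist; case: pselect => [h|h].
  case: ex_minnP => m xym mmin; rewrite lef_pV2 ?posrE ?exprn_gt0//.
  rewrite ler_eXn2l ?ltr1n//; split=> [nm k kn|H].
    apply/eqP/negPn/negP => /mmin mk.
    by move: (leq_trans kn nm); rewrite ltnNge mk.
  by rewrite leqNgt; apply/negP => /H /eqP; rewrite (negbTE xym).
split=> [_ k _|_]; last by rewrite invr_ge0 exprn_ge0.
by apply/eqP/negPn/negP => xyk; apply: h; exists k.
Qed.

Lemma wdistxx x : wdist x x = 0.
Proof.
rewrite /wdist; case: pselect => // h; exfalso.
by case: h => n; rewrite eqxx.
Qed.

Lemma wdist_positivity x y : wdist x y = 0 -> x = y.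
Proof.
rewrite /wdist; case: pselect => [h /eqP|h _].
  by rewrite invr_eq0 expf_eq0 pnatr_eq0 andbF.
by apply/funext => n; apply/eqP/negPn/negP => xyn; apply: h; exists n.
Qed.

Lemma wdist_values x y : wdist x y = 0 \/ exists n, wdist x y = 2 ^- n.
Proof. by rewrite /wdist; case: pselect => h; [right; eexists|left]. Qed.

Lemma wdist_ge0 x y : 0 <= wdist x y.
Proof.
by have [->//|[n ->]] := wdist_values x y; rewrite invr_ge0 exprn_ge0.
Qed.

Lemma wdist_sym x y : wdist x y = wdist y x.
Proof.
have H (u v : infword R) : wdist v u <= wdist u v.
  have [/wdist_positivity ->|[n E]] := wdist_values u v; first by [].
  rewrite E; apply/wdist_le => k kn; symmetry.
  by move: k kn; apply/wdist_le; rewrite E.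
by apply/eqP; rewrite eq_le !H.
Qed.

Lemma wdist_ultra y x z : wdist x z <= Num.max (wdist x y) (wdist y z).
Proof.
have [xy|[n xy]] := wdist_values x y.
  by move/wdist_positivity: xy => ->; rewrite le_max lexx orbT.
have [yz|[m yz]] := wdist_values y z.
  by move/wdist_positivity: yz => ->; rewrite le_max lexx.
have Hn k : (k < n)%N -> x k = y k by move: k; apply/wdist_le; rewrite xy.
have Hm k : (k < m)%N -> y k = z k by move: k; apply/wdist_le; rewrite yz.
rewrite xy yz le_max; apply/orP; case: (leqP n m) => nm; [left|right];
  apply/wdist_le => k kn.
  by rewrite Hn// Hm// (leq_trans kn).
by rewrite Hn ?Hm// (ltn_trans kn).
Qed.

Lemma wdist_triangle y x z : wdist x z <= wdist x y + wdist y z.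
Proof.
apply: le_trans (wdist_ultra y x z) _.
by rewrite ge_max lerDl lerDr !wdist_ge0.
Qed.

End Metric.

(* The topology on X^omega is the one of the metric d; d is [mdist]. *)
HB.instance Definition _ (R : realType) :=
  isMetric.Build R (infword R) (@wdistxx R) (@wdist_positivity R)
    (@wdist_sym R) (@wdist_triangle R).

Lemma mdistE (R : realType) (x y : infword R) : mdist x y = wdist x y.
Proof. by []. Qed.

Definition catw (R : realType) (q : seq bool) (x : infword R) : infword R :=
  fun n => if (n < size q)%N then nth false q n else x (n - size q)%N.

Record isom (R : realType) := Isom {
  isom_fun :> infword R -> infword R ;
  isom_bij : bijective isom_fun ;
  isom_dist : forall x y, mdist (isom_fun x) (isom_fun y) = mdist x y }.

(* Gamma u {0}: [Some p] stands for the coefficient 2^p and [None] for 0. The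
   topology is the one in which Gamma is discrete and 2^p tends to 0 when p
   tends to +oo, which is induced by nu(2^p) = 2^-p, nu(0) = 0. *)
Definition nu (R : realType) (e : option int) : R :=
  if e is Some p then 2 ^ (- p) else 0.

Definition scale (R : realType) := initial_topology (@nu R).

(* [dil p] is the dilatation of coefficient 2^p, p in Z, totalized: for p < 0
   its value at (x, y) is meaningful only when y lies in W_{2^p}(x).
   [domV p x] is V_{2^p}(x) (p >= 0), [domW p x] is W_{2^-p}(x) (p >= 1; the
   set [domW 0 x] is not used). *)
Record dil_data (R : realType) := DilData {
  dil : int -> infword R -> infword R -> infword R ;
  domV : nat -> infword R -> set (infword R) ;
  domW : nat -> infword R -> set (infword R) ;
  dist_at : infword R -> infword R -> infword R -> R }.

Section DilatationAxioms.
Variables (R : realType) (D : dil_data R).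
Local Notation Xw := (infword R).
Local Notation delta := (dil D).
Local Notation V := (domV D).
Local Notation W := (domW D).

Definition dil_dom (p : int) (x : Xw) : set Xw :=
  match p with Posz _ => setT | Negz n => W n.+1 x end.

(* dom delta, as a subset of (Gamma u {0}) x X^omega x X^omega *)
Definition dom_delta : set (scale R * Xw * Xw) :=
  [set t | if t.1.1 is Some p then dil_dom p t.1.2 t.2 else False].

(* Axiom A0 allows the image of delta^x_{2^p} to be smaller than V_{2^p}(x), so
   "homeomorphism" is understood as "homeomorphism onto its image". *)
Definition homeo_onto_image (f : Xw -> Xw) : Prop :=
  continuous f /\
  exists2 g : Xw -> Xw, cancel f g & {within range f, continuous g}.

Definition axiom_A0 : Prop :=
  [/\ (forall (p : nat) x, open (V p x)) /\
      (forall (p : nat) x, (0 < p)%N -> open (W p x)),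
      forall (p : nat) x,
        [/\ homeo_onto_image (delta p x),
            [set y | mdist x y <= 2 ^- p] `<=` range (delta p x) &
            range (delta p x) `<=` V p x],
      forall (p : nat) x, (0 < p)%N ->
        [/\ {in W p x &, injective (delta (- p%:Z) x)},
            V p x `<=` W p x &
            forall u, delta (- p%:Z) x (delta p x u) = u] &
      exists r : R, exists p1 : nat, 0 < r /\
        forall (p : nat) x u v, (0 < p)%N -> (p1 <= p)%N ->
          mdist x u <= r -> mdist x v <= r ->
          W p (delta p x u) (delta p x v)].

(* [E] is the continuous extension of delta from its domain to the closure of
   this domain; it also serves to state the continuity of delta on its domain,
   where both coincide. *)
Definition axiom_A1 : Prop :=
  [/\ forall (p : int) x, delta p x x = x,
      forall x y, delta 0 x y = y &
      exists E : scale R * Xw * Xw -> Xw,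
        [/\ forall (p : int) x y, dil_dom p x y ->
              E ((Some p : scale R), x, y) = delta p x y,
            {within dom_delta, continuous E},
            {within closure dom_delta, continuous E} &
            forall x y, delta (Posz p) x y @[p --> \oo] --> x]].

Definition axiom_A2 : Prop :=
  forall (p r : nat) x u, delta p x (delta r x u) = delta (p + r)%N x u.

Definition axiom_A3 : Prop :=
  (forall e : R, 0 < e -> \forall p \near \oo, forall x u v,
     `|2 ^+ p * mdist (delta (Posz p) x u) (delta (Posz p) x v)
        - dist_at D x u v| < e) /\
  (forall x u v, dist_at D x u v = 0 -> u = v).

Definition weak_dilatation_structure : Prop :=
  [/\ axiom_A0, axiom_A1, axiom_A2 & axiom_A3].

Definition stable_from (n : nat) : Prop :=
  forall p x u v, (n <= p)%N ->
    2 ^+ p * mdist (delta (Posz p) x u) (delta (Posz p) x v) = dist_at D x u v.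

Definition is_p0 (n : nat) : Prop :=
  stable_from n /\ forall m, stable_from m -> (n <= m)%N.

(* All dilatations are obtained from d2; the domain of the dilatation of
   coefficient 2^-p is the image of the one of coefficient 2^p. *)
Definition induced_by (d2 : Xw -> Xw -> Xw) : Prop :=
  (forall (p : nat) x u, delta p x u = iter p (d2 x) u) /\
  (forall (p : nat) x, (0 < p)%N ->
     W p x = range (delta p x) /\
     forall u, delta (- p%:Z) x (delta p x u) = u).

End DilatationAxioms.

Definition posn : Type := {n : nat | (0 < n)%N}.

Definition posS (n : nat) : posn := exist _ n.+1 (ltn0Sn n).

Definition smooth (R : realType) (W : posn -> infword R -> isom R) : Prop :=
  forall e : R, 0 < e -> exists2 mu : R, 0 < mu &
    forall x x' : infword R, mdist x x' < mu ->
    forall (y : infword R) (k : posn), mdist x x' < 2 ^- sval k ->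
      2 ^- sval k * mdist (W k x y) (W k x' y) <= e.

(* delta_2^{q a x} (q (~a) y) = q a (~x_1) W^{q a x}_{|q|+1} (y) *)
Definition dil2_rel (R : realType) (W : posn -> infword R -> isom R)
    (d2 : infword R -> infword R -> infword R) : Prop :=
  forall (q : seq bool) (a : bool) (x y : infword R),
    d2 (catw (rcons q a) x) (catw (rcons q (~~ a)) y) =
    catw (q ++ [:: a; ~~ x 0%N]) (W (posS (size q)) (catw (rcons q a) x) y).

Definition is_dil2_of (R : realType) (W : posn -> infword R -> isom R)
    (d2 : infword R -> infword R -> infword R) : Prop :=
  (forall x, d2 x x = x) /\ dil2_rel W d2.

(* Main.v *)
Require Import Defs.
From HB Require Import structures.
From mathcomp Require Import all_boot all_order all_algebra.
From mathcomp Require Import all_classical all_reals all_analysis.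
From mathcomp Require Import zify.

(** Every distance is 0 or some 2^-n, so that everything can be said in terms
    of common prefixes: [agree n x y] means [d(x, y) <= 2^-n].

    From dilatations to isometries. When [p_0 = 0], the map [delta^x_2] fixes
    [x], halves all distances, and its image is the ball of radius 1/2 around
    [x]. A word that leaves [x] after the prefix [q] is therefore mapped to a
    word that leaves [x] exactly one letter later ([half_first_diff]), and the
    remaining letters are transformed by a map that preserves distances and is
    onto: this is the isometry [W^x_{|q|+1}] ([half_isom]). Smoothness of [W] is
    the statement that [delta^x_2 y] is continuous in [x], uniformly in [x] and
    [y]. It follows from the joint continuity in the axiom A1 and from
    compactness ([jointly_continuous_uniform]).

    From isometries to dilatations. A pair of distinct words has a unique first
    difference, so that the relation determines [delta^x_2] off [x]
    ([dil2_exists], [dil2_unique]). This map halves distances ([dil2_half]) and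
    its image is the ball of radius 1/2 ([dil2_onto]), so that its [p]-th
    iterate divides distances by 2^p and has the ball of radius 2^-p as its
    image; the axioms A0, A2, A3 and [p_0 = 0] follow. For A1, smoothness gives
    the joint continuity of [delta^x_2 y] ([dil2_jointly_continuous]), hence of
    its iterates and, as the inverses of these multiply distances by a constant,
    of the inverses ([dil2_inverse_exists]). The balls being open and closed,
    the inverses extend continuously to all pairs of points, and the continuity
    at the coefficient 0 is that of the estimate [d(x, delta^x_{2^p} y) <= 2^-p]. *)

Set Implicit Arguments.
Unset Strict Implicit.
Unset Printing Implicit Defensive.

Import Order.TTheory GRing.Theory Num.Theory numFieldNormedType.Exports.

Local Open Scope classical_set_scope.
Local Open Scope ring_scope.

(** * Words and common prefixes *)

Section Words.
Variable R : realType.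
Local Notation Xw := (infword R).
Implicit Types (x y z u v : Xw) (q : seq bool).

Definition agree (n : nat) x y : Prop := forall k, (k < n)%N -> x k = y k.

Definition prefw (n : nat) x : seq bool := mkseq x n.

Definition tailw (n : nat) x : Xw := fun k => x (n + k)%N.

(** [n] is the position of the first letter where [x] and [y] differ; since
    there are two letters, that of [y] is determined by that of [x]. *)
Definition first_diff (n : nat) x y : Prop := agree n x y /\ y n = ~~ x n.

Lemma agree_refl n x : agree n x x. Proof. by []. Qed.

Lemma agree0 x y : agree 0 x y. Proof. by []. Qed.

Lemma agree_sym n x y : agree n x y -> agree n y x.
Proof. by move=> H k kn; rewrite H. Qed.

Lemma agree_trans n y x z : agree n x y -> agree n y z -> agree n x z.
Proof. by move=> H K k kn; rewrite H ?K. Qed.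

Lemma agree_le m n x y : (m <= n)%N -> agree n x y -> agree m x y.
Proof. by move=> mn H k km; apply: H; apply: leq_trans mn. Qed.

Lemma agree_all x y : (forall n, agree n x y) -> x = y.
Proof. by move=> H; apply/funext => k; apply: (H k.+1). Qed.

Lemma size_prefw n x : size (prefw n x) = n. Proof. exact: size_mkseq. Qed.

Lemma catwS q b x : catw (R := R) (rcons q b) x (size q) = b.
Proof. by rewrite /catw size_rcons ltnSn nth_rcons ltnn eqxx. Qed.

Lemma catw_lt q q' x x' k : (k < size q)%N ->
  catw (R := R) (q ++ q') x k = catw q x' k.
Proof.
by move=> kq; rewrite /catw kq size_cat (leq_trans kq (leq_addr _ _)) nth_cat kq.
Qed.

Lemma catw_prefw n x : catw (prefw n x) (tailw n x) = x.
Proof.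
apply/funext => k; rewrite /catw size_prefw /tailw.
by case: ltnP => kn; [rewrite nth_mkseq|rewrite subnKC].
Qed.

Lemma agree_prefw n x y : agree n x y -> prefw n x = prefw n y.
Proof.
move=> H; apply: (@eq_from_nth _ false); rewrite !size_prefw// => k kn.
by rewrite !nth_mkseq// H.
Qed.

Lemma prefw_agree n x y : agree n x (catw (prefw n x) y).
Proof. by move=> k kn; rewrite /catw size_prefw kn nth_mkseq. Qed.

Lemma prefw_cat q q' x : prefw (size q) (catw (R := R) (q ++ q') x) = q.
Proof.
apply: (@eq_from_nth _ false); rewrite !size_prefw// => k kn.
by rewrite nth_mkseq// (catw_lt _ _ x)// /catw kn.
Qed.

Lemma prefw_catw q x : prefw (size q) (catw (R := R) q x) = q.
Proof. by rewrite -[in catw q x](cats0 q) prefw_cat. Qed.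

Lemma tailw_catw q x : tailw (size q) (catw q x) = x.
Proof.
by apply/funext => k; rewrite /tailw /catw ltnNge leq_addr addKn.
Qed.

Lemma prefwS n x : prefw n.+1 x = rcons (prefw n x) (x n).
Proof.
apply: (@eq_from_nth _ false); rewrite ?size_rcons !size_prefw// => k kn.
rewrite nth_rcons size_prefw nth_mkseq//.
by move: kn; rewrite ltnS leq_eqVlt => /orP[/eqP->|kn];
  rewrite ?ltnn ?eqxx// kn nth_mkseq.
Qed.

Lemma agree_catw n q x y :
  agree n (catw (R := R) q x) (catw q y) <-> agree (n - size q) x y.
Proof.
split=> [H k|H k kn].
  rewrite ltn_subRL => /H; rewrite /catw ltnNge leq_addr/=.
  by rewrite addKn.
by rewrite /catw; case: ltnP => // qk; apply: H; rewrite ltn_sub2r// (leq_ltn_trans qk).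
Qed.

Lemma tailw_prefw n b x y : tailw n.+1 (catw (rcons (prefw n x) b) y) = y.
Proof.
have := tailw_catw (rcons (prefw n x) b) y.
by rewrite size_rcons size_prefw.
Qed.

Lemma first_diff_exists x y : x <> y -> exists n, first_diff n x y.
Proof.
move=> xy; have h : exists n, x n != y n.
  apply: contrapT => h; apply: xy; apply/funext => n; apply/eqP/negPn/negP => k.
  by apply: h; exists n.
exists (ex_minn h); case: ex_minnP => n xyn nmin; split=> [k kn|].
  by apply/eqP/negPn/negP => /nmin; rewrite leqNgt kn.
by case: (x n) (y n) xyn => -[].
Qed.

Lemma first_diff_sep n m x u v : first_diff n x u -> agree n.+1 x v ->
  agree m u v <-> (m <= n)%N.
Proof.
move=> [xu un] xv; split=> [H|mn].
  rewrite leqNgt; apply/negP => nm; have := H _ nm.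
  by rewrite -xv// un; case: (x n).
apply: (@agree_trans _ x); apply: agree_le mn _; first exact: agree_sym.
exact: agree_le xv.
Qed.

Lemma first_diff_catw n x y :
  first_diff n x (catw (rcons (prefw n x) (~~ x n)) y).
Proof.
split=> [k kn|].
  rewrite -cats1 (@catw_lt _ _ _ y) ?size_prefw//; exact: prefw_agree.
by rewrite -[n in catw _ _ n](size_prefw n x) catwS.
Qed.

Lemma first_diffE n x y : first_diff n x y ->
  y = catw (rcons (prefw n x) (~~ x n)) (tailw n.+1 y).
Proof.
by move=> [/agree_prefw-> <-]; rewrite -prefwS catw_prefw.
Qed.

End Words.

(** * The distance in terms of common prefixes *)

Section Distance.
Variable R : realType.
Local Notation Xw := (infword R).
Implicit Types (x y z u v : Xw) (q : seq bool).

Lemma mdist_leP x y n : (mdist x y <= 2 ^- n) <-> agree n x y.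
Proof. exact: wdist_le. Qed.

Lemma pow2V_gt0 n : 0 < 2 ^- n :> R.
Proof. by rewrite invr_gt0 exprn_gt0. Qed.

Lemma pow2V_lt m n : (m < n)%N -> 2 ^- n < 2 ^- m :> R.
Proof. by move=> mn; rewrite ltf_pV2 ?posrE ?exprn_gt0// ltr_eXn2l ?ltr1n. Qed.

Lemma mdist_ltP x y n : (mdist x y < 2 ^- n) <-> agree n.+1 x y.
Proof.
split=> [|/mdist_leP H]; last exact: le_lt_trans H (pow2V_lt (ltnSn n)).
have [/wdist_positivity-> //|[m E]] := wdist_values x y.
rewrite mdistE E ltf_pV2 ?posrE ?exprn_gt0// ltr_eXn2l ?ltr1n// => nm.
apply/mdist_leP; rewrite mdistE E.
by rewrite lef_pV2 ?posrE ?exprn_gt0// ler_eXn2l ?ltr1n.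
Qed.

Lemma pow2V_small (e : R) : 0 < e -> exists n, 2 ^- n < e.
Proof.
move=> e0; have [N _ H] := near_infty_natSinv_expn_lt (PosNum e0).
by exists N; have := H N (leqnn N); rewrite /= div1r.
Qed.

(** The values of the distance are powers of 2 and 0, so that one value being
    [2 ^+ p] times another amounts to the common prefix being [p] letters
    shorter. *)
Lemma mdist_scaleP p u v u' v' :
  2 ^+ p * mdist u' v' = mdist u v <->
  forall n, agree n u v <-> agree (p + n) u' v'.
Proof.
have p0 : 0 < 2 ^+ p :> R by rewrite exprn_gt0.
have eqV n : 2 ^+ p * 2 ^- (p + n) = 2 ^- n :> R.
  by rewrite exprD invfM mulrA mulfV ?mul1r// gt_eqF.
split=> [E n|H].
  by rewrite -!mdist_leP -E -eqV ler_pM2l.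
have [/wdist_positivity uv|[m uv]] := wdist_values u v.
  have -> : u' = v'.
    apply: agree_all => n; apply: (@agree_le _ _ (p + n)); first exact: leq_addl.
    by apply/H; rewrite uv.
  by rewrite uv !mdistE !wdistxx mulr0.
rewrite !mdistE uv -eqV; congr (_ * _).
apply/eqP; rewrite eq_le; apply/andP; split.
  by apply/mdist_leP/H/mdist_leP; rewrite mdistE uv.
rewrite leNgt; apply/negP => /mdist_ltP; rewrite -addnS => /H /mdist_ltP.
by rewrite mdistE uv ltxx.
Qed.

Lemma nbhs_agree x (A : set Xw) :
  nbhs x A <-> exists n, forall y, agree n x y -> A y.
Proof.
split=> [/nbhs_ballP[e/= /pow2V_small[n ne] eA]|[n nA]].
  exists n => y xy; apply: eA; rewrite ballEmdist/=.
  by apply: le_lt_trans ne; apply/mdist_leP.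
apply/nbhs_ballP; exists (2 ^- n); first exact: pow2V_gt0.
by move=> y; rewrite ballEmdist/= => /mdist_ltP /(agree_le (leqnSn n)) /nA.
Qed.

Lemma open_agree x n : open [set y : Xw | agree n x y].
Proof.
by rewrite openE => y xy; apply/nbhs_agree; exists n => z; apply: agree_trans.
Qed.

Lemma isom_agree (W : isom R) n x y : agree n (W x) (W y) <-> agree n x y.
Proof. by rewrite -!mdist_leP isom_dist. Qed.

End Distance.

(** * From joint continuity to uniformity *)

Section Uniformity.
Variable R : realType.
Local Notation Xw := (infword R).

(** Continuity of [(x, y) |-> f x y] on the product, cylinders being a basis of
    neighbourhoods. *)
Definition jointly_continuous (f : Xw -> Xw -> Xw) : Prop :=
  forall x y n, exists m, forall x' y', agree m x x' -> agree m y y' ->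
    agree n (f x y) (f x' y').

(** Compactness of the space of infinite words, in the form of König's lemma:
    were there no uniform bound, one could extend the empty word letter by
    letter so that none of its extensions has a uniform bound on its cylinder;
    the infinite word so obtained has no locally uniform bound. *)
Lemma locally_uniform_bound (Q : Xw -> nat -> Prop) :
  (forall x m n, (m <= n)%N -> Q x m -> Q x n) ->
  (forall x, exists m N, forall x', agree m x x' -> Q x' N) ->
  exists N, forall x, Q x N.
Proof.
move=> mono loc; pose good q := exists N, forall x, Q (catw q x) N.
have step q : exists b, good (rcons q b) -> good q.
  apply: contrapT => nb; have all_good b : good (rcons q b).
    apply: contrapT => ngood; apply: nb; exists b; by move/ngood.
  apply: nb; exists true => _.
  have [N1 H1] := all_good true; have [N0 H0] := all_good false.
  exists (maxn N1 N0) => x.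
  have -> : catw q x = catw (rcons q (x 0%N)) (tailw 1 x).
    rewrite -[LHS](catw_prefw (size q).+1) prefwS prefw_catw.
    rewrite [catw q x _]/catw ltnn subnn; congr catw.
    apply/funext => k; rewrite /tailw /catw ltnNge ltnW ?leq_addr//=.
    by rewrite addSnnS addKn add1n.
  case: (x 0%N); first exact: mono (leq_maxl _ _) (H1 _).
  exact: mono (leq_maxr _ _) (H0 _).
have [c cP] := boolp.choice step.
pose qs := fix qs n := if n is n'.+1 then rcons (qs n') (c (qs n')) else [::].
pose x : Xw := fun n => c (qs n).
have qsE n : qs n = prefw n x by elim: n => // n IH; rewrite prefwS -IH.
suff [N QN] : good [::].
  exists N => y; have := QN y; congr (Q _ N).
  by apply/funext => k; rewrite /catw /= subn0.
have [m [N xN]] := loc x.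
have : good (qs m).
  by exists N => y; apply: xN; rewrite qsE; apply: prefw_agree.
by elim: m {xN} => //= m IH /cP.
Qed.

(** The bound must be uniform both in the base point and in the argument: for
    each base point compactness is used once in the argument, and then once
    more in the base point. *)
Lemma jointly_continuous_uniform f : jointly_continuous f ->
  forall n, exists m, forall x x' y, agree m x x' -> agree n (f x y) (f x' y).
Proof.
move=> fC n.
pose Q x m := forall x' y, agree m x x' -> agree n (f x y) (f x' y).
suff [N QN] : exists N, forall x, Q x N by exists N => x x' y; apply: QN.
apply: locally_uniform_bound => [x k m km H x' y /(agree_le km)/H//|x].
have [m xm] : exists m, forall y x', agree m x x' -> agree n (f x y) (f x' y).
  apply: (@locally_uniform_bound
    (fun y m => forall x', agree m x x' -> agree n (f x y) (f x' y))).
    by move=> y k m km H x' /(agree_le km)/H.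
  move=> y; have [m H] := fC x y n; exists m, m => y' yy' x' xx'.
  by apply: agree_trans (H _ _ xx' yy'); apply/agree_sym/H.
exists m, m => x' xx' x'' y x'x''.
apply: agree_trans (xm y x'' (agree_trans xx' x'x'')).
exact/agree_sym/xm.
Qed.

End Uniformity.

(** * The isometries associated with a dilatation structure *)

Section FromDilatations.
Variable R : realType.
Local Notation Xw := (infword R).

Section BasePoint.
Variables (x : Xw) (S : Xw -> Xw).
Hypothesis S_fix : S x = x.
Hypothesis S_half : forall n u v, agree n u v <-> agree n.+1 (S u) (S v).
Hypothesis S_onto : forall v, agree 1 x v -> exists u, S u = v.

(** Halving distances moves the first difference with the fixed point by one
    position. *)
Lemma half_first_diff n u : first_diff n x u <-> first_diff n.+1 x (S u).
Proof.
have sep k v : first_diff k x v <-> agree k x v /\ ~ agree k.+1 x v.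
  split=> [[xv vk]|[xv nxv]].
    by split=> // /(_ k (ltnSn k)); rewrite vk; case: (x k).
  split=> //; apply: contrapT => vk; apply: nxv => j; rewrite ltnS leq_eqVlt.
  case/orP=> [/eqP->|]; last exact: xv.
  by move: vk; case: (v k) (x k) => -[] // /(_ erefl).
have H k : agree k x u <-> agree k.+1 x (S u) by rewrite S_half S_fix.
by rewrite !sep -!H.
Qed.

(** The words that leave [x] at position [n] form a copy of the whole space, and
    [S] maps them bijectively, halving distances, to those that leave [x] at
    position [n.+1]. *)
Lemma half_isom n : exists W : isom R, forall y,
  S (catw (rcons (prefw n x) (~~ x n)) y) =
  catw (rcons (prefw n.+1 x) (~~ x n.+1)) (W y).
Proof.
pose q := rcons (prefw n x) (~~ x n).
pose W y : Xw := tailw n.+2 (S (catw q y)).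
have SE y : S (catw q y) = catw (rcons (prefw n.+1 x) (~~ x n.+1)) (W y).
  exact/first_diffE/(half_first_diff _ _).1/first_diff_catw.
have Wagree k y z : agree k (W y) (W z) <-> agree k y z.
  have sz b m : size (rcons (prefw m x) b) = m.+1.
    by rewrite size_rcons size_prefw.
  have := S_half (n.+1 + k) (catw q y) (catw q z).
  by rewrite !SE /q !agree_catw !sz subSS !addKn => ->.
have Wdist y z : mdist (W y) (W z) = mdist y z.
  by rewrite -[LHS]mul1r -[1](expr0 2); apply/mdist_scaleP => k; rewrite Wagree.
have Wonto z : exists y, W y = z.
  have zd := first_diff_catw n.+1 x z.
  have [u Su] : exists u, S u = catw (rcons (prefw n.+1 x) (~~ x n.+1)) z.
    by apply: S_onto; apply: agree_le zd.1.
  exists (tailw n.+1 u).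
  rewrite -Su in zd; have /first_diffE uE := (half_first_diff _ _).2 zd.
  by rewrite /W -uE Su tailw_prefw.
have [V VK] := boolp.choice Wonto.
have WK : cancel W V.
  by move=> y; apply: agree_all => k; apply/Wagree; rewrite VK.
by exists (Isom (Bijective WK VK) Wdist).
Qed.

End BasePoint.

Section Structure.
Variable D : dil_data R.
Hypothesis Dweak : weak_dilatation_structure D.
Hypothesis Dp0 : is_p0 D 0%N.
Local Notation delta2 := (dil D 1%R).

Lemma delta2_half x n u v :
  agree n u v <-> agree n.+1 (delta2 x u) (delta2 x v).
Proof.
have [_ [_ delta0 _] _ _] := Dweak.
have := Dp0.1 0%N x u v (leqnn 0%N); rewrite expr0 mul1r !delta0 => E0.
have := Dp0.1 1%N x u v isT; rewrite -E0 => /mdist_scaleP H.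
by rewrite (H n) add1n.
Qed.

Lemma delta2_onto x v : agree 1 x v -> exists u, delta2 x u = v.
Proof.
have [[_ A0 _ _] _ _ _] := Dweak; have [_ sub _] := A0 1%N x.
by move=> /mdist_leP /sub[u _ <-]; exists u.
Qed.

Lemma delta2_jointly_continuous : jointly_continuous delta2.
Proof.
have [_ [_ _ [E [EE + _ _]]] _ _] := Dweak => /subspace_continuousP Ec.
move=> x y n; pose t : scale R * Xw * Xw := (Some 1, x, y).
have td : dom_delta D t by [].
have nB : nbhs (E t) [set z | agree n (delta2 x y) z].
  by apply/nbhs_agree; exists n => z; rewrite EE.
have /= := Ec t td _ nB; rewrite /nbhs/=.
move=> [[P Q] /= [nP /nbhs_agree[m2 Qm]] PQ].
case: nP => -[P1 P2] /= [nP1 /nbhs_agree[m1 Pm]] P12.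
exists (maxn m1 m2) => x' y' xx' yy'.
have /= := PQ (Some 1, x', y'); rewrite [from_subspace _ _ _]EE//; apply=> //; split => /=.
  apply: P12; split => /=; first exact: nbhs_singleton nP1.
  by apply/Pm/(agree_le (leq_maxl _ _) xx').
by apply/Qm/(agree_le (leq_maxr _ _) yy').
Qed.

(** The isometries are obtained pointwise. Where two base points have the same
    [k.+1] first letters, the same prefix of length [k.+1] can be removed from
    the values of the two dilatations, so that smoothness of the isometries is
    the uniform continuity of the dilatation in its base point. *)
Lemma isom_of_dilatation : exists W : posn -> Xw -> isom R,
  smooth W /\ dil2_rel W delta2.
Proof.
have [_ [delta_fix _ _] _ _] := Dweak.
have ex (kx : posn * Xw) : exists W : isom R, forall y,
    delta2 kx.2 (catw (rcons (prefw (sval kx.1).-1 kx.2)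
                             (~~ kx.2 (sval kx.1).-1)) y) =
    catw (rcons (prefw (sval kx.1) kx.2) (~~ kx.2 (sval kx.1))) (W y).
  case: kx => -[[//|k] k0] x /=.
  exact: half_isom (delta_fix _ _) (delta2_half x) (@delta2_onto x) k.
have [W0 W0P] := boolp.choice ex.
pose W k x := W0 (k, x); have WP k x := W0P (k, x); rewrite /= in WP.
exists W; split=> [e e0|q a x y].
  have [n ne] := pow2V_small (divr_gt0 e0 (ltr0Sn _ 1)).
  have [m mP] := jointly_continuous_uniform delta2_jointly_continuous n.
  exists (2 ^- m); first exact: pow2V_gt0.
  move=> x x' /mdist_ltP/(agree_le (leqnSn m))/mP xx' y k /mdist_ltP kxx'.
  move: {xx'}(xx' (catw (rcons (prefw (sval k).-1 x) (~~ x (sval k).-1)) y)).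
  have E : rcons (prefw (sval k).-1 x) (~~ x (sval k).-1) =
           rcons (prefw (sval k).-1 x') (~~ x' (sval k).-1).
    have km : ((sval k).-1 <= sval k)%N := leq_pred _.
    rewrite (agree_prefw (agree_le km (agree_le (leqnSn _) kxx'))).
    by rewrite kxx'// ltnS.
  rewrite [in X in agree n _ X]E !WP.
  rewrite -(agree_prefw (agree_le (leqnSn _) kxx')) -(kxx' _ (ltnSn _)).
  set q := rcons _ _ => /mdist_leP qn.
  (* Removing a prefix of length [k.+1] multiplies distances by 2^(k.+1), and the
     isometries are only compared up to the factor 2^-k: a factor 2 is lost. *)
  have <- : 2 ^+ (sval k).+1 * mdist (catw q (W k x y)) (catw q (W k x' y)) =
            mdist (W k x y) (W k x' y).
    apply/mdist_scaleP => j.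
    by rewrite agree_catw /q size_rcons size_prefw addKn.
  rewrite mulrA exprS mulrCA mulVf ?expf_neq0 ?pnatr_eq0// mulr1 mulrC.
  rewrite -ler_pdivlMr//; exact: le_trans qn (ltW ne).
have := WP (posS (size q)) (catw (rcons q a) x) y.
rewrite [sval _]/= [_.-1]/=.
have pq : prefw (size q) (catw (rcons q a) x) = q.
  by rewrite -cats1 prefw_cat.
rewrite prefwS pq catwS => ->.
have -> : catw (rcons q a) x (size q).+1 = x 0%N.
  by rewrite /catw size_rcons ltnn subnn.
by rewrite -!cats1 -catA.
Qed.

End Structure.
End FromDilatations.

(** * The dilatation structure associated with a smooth function *)

Section Scale.
Variable R : realType.

(** Nonzero coefficients are isolated, as the values 2^-p of [nu] are. *)
Lemma nbhs_scale_Some (p : int) :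
  nbhs (Some p : scale R) [set Some p : scale R].
Proof.
have lt2 : 1 < 2 :> R by rewrite ltr1n.
have H : (2 ^ (- p) : R) \in `]2 ^ (- p - 1), 2 ^ (- p + 1)[.
  by rewrite in_itv/= !ltr_eXz2l//; apply/andP; split; lia.
have nP : nbhs (Some p : scale R) (@nu R @^-1` _) :=
  @initial_continuous _ _ (@nu R) (Some p) _ (near_in_itvoo H).
apply: filterS nP => -[q|]; rewrite /= in_itv/=.
  rewrite !ltr_eXz2l// => pq; congr Some.
  have -> : q = p by lia.
  by [].
by rewrite ltNge exprz_ge0.
Qed.

Lemma nbhs_scale_None n :
  nbhs (None : scale R)
    [set s : scale R | if s is Some p then (n%:Z <= p)%R else True].
Proof.
have lt2 : 1 < 2 :> R by rewrite ltr1n.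
have nB : nbhs (nu R None) [set r : R | r < 2 ^ (- n%:Z + 1)].
  by apply: lt_nbhsl; rewrite /= exprz_gt0.
have nP : nbhs (None : scale R) (@nu R @^-1` _) :=
  @initial_continuous _ _ (@nu R) None _ nB.
apply: filterS nP => -[q|//]; rewrite /= ltr_eXz2l//; lia.
Qed.

End Scale.

Section FromIsometries.
Variables (R : realType) (W : posn -> infword R -> isom R).
Local Notation Xw := (infword R).

Lemma first_diff_inj n m (x u : Xw) :
  first_diff n x u -> first_diff m x u -> n = m.
Proof.
move=> [xu un] [xu' um].
by case: (ltngtP n m) => // lt; [move: un; rewrite -xu'//|move: um; rewrite -xu//];
  case: (x _).
Qed.

(** The relation that defines dilatations of coefficient 2 in terms of words,
    read at the first difference of two given words. *)
Lemma dil2_relE (d2 : Xw -> Xw -> Xw) : dil2_rel W d2 <->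
  forall n x u, first_diff n x u -> d2 x u =
    catw (rcons (prefw n.+1 x) (~~ x n.+1)) (W (posS n) x (tailw n.+1 u)).
Proof.
split=> [H n x u xu|H q a x y].
  have := H (prefw n x) (x n) (tailw n.+1 x) (tailw n.+1 u).
  rewrite -first_diffE// -prefwS catw_prefw => ->.
  by rewrite size_prefw {1}/tailw addn0 prefwS -!cats1 -catA.
pose w := catw (rcons q a) x.
have wq : prefw (size q) w = q by rewrite /w -cats1 prefw_cat.
have wa : w (size q) = a by rewrite /w catwS.
have wx : w (size q).+1 = x 0%N by rewrite /w /catw size_rcons ltnn subnn.
have := H (size q) w _ (first_diff_catw (size q) w y).
rewrite prefwS wq wa wx -[in tailw _ _](size_rcons q (~~ a)) tailw_catw -/w => ->.
by congr (catw _ _); rewrite -!cats1 -catA.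
Qed.

Lemma dil2_unique d2 d2' : is_dil2_of W d2 -> is_dil2_of W d2' -> d2 = d2'.
Proof.
move=> [fix2 /dil2_relE H] [fix2' /dil2_relE H'].
apply/funext => x; apply/funext => y.
have [<-|/first_diff_exists[n xy]] := pselect (x = y); first by rewrite fix2 fix2'.
by rewrite (H _ _ _ xy) (H' _ _ _ xy).
Qed.

Lemma dil2_exists : exists d2, is_dil2_of W d2.
Proof.
have ex (xy : Xw * Xw) : exists z, (xy.1 = xy.2 -> z = xy.1) /\
    forall n, first_diff n xy.1 xy.2 -> z =
      catw (rcons (prefw n.+1 xy.1) (~~ xy.1 n.+1))
           (W (posS n) xy.1 (tailw n.+1 xy.2)).
  case: xy => x y /=.
  have [<-|nxy] := pselect (x = y).
    by exists x; split=> // n [_]; case: (x n).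
  have [n xy] := first_diff_exists nxy.
  exists (catw (rcons (prefw n.+1 x) (~~ x n.+1))
               (W (posS n) x (tailw n.+1 y))).
  by split=> [/nxy//|m /(first_diff_inj xy) <-].
have [f fP] := boolp.choice ex.
exists (fun x y => f (x, y)); split=> [x|]; first exact: (fP (x, x)).1.
by apply/dil2_relE => n x y; apply: (fP (x, y)).2.
Qed.

Variable d2 : Xw -> Xw -> Xw.
Hypothesis d2W : is_dil2_of W d2.

Let d2_fix x : d2 x x = x. Proof. exact: d2W.1. Qed.

Let d2E := (dil2_relE d2).1 d2W.2.

Lemma dil2_first_diff n x u : first_diff n x u -> first_diff n.+1 x (d2 x u).
Proof. by move/d2E->; apply: first_diff_catw. Qed.

(** If [u] and [v] leave [x] at different positions, then their first difference
    is at the smaller one, and [d2] moves it by one; if they leave [x] at the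
    same position, then their tails are compared through an isometry. *)
Lemma dil2_half x n u v : agree n u v <-> agree n.+1 (d2 x u) (d2 x v).
Proof.
have fd k w : first_diff k x w -> agree k.+1 x (d2 x w) by case/dil2_first_diff.
have sep i a b : first_diff i x a -> agree i.+1 x b -> agree i.+2 x (d2 x b) ->
    agree n a b <-> agree n.+1 (d2 x a) (d2 x b).
  move=> xa xb xdb; rewrite (first_diff_sep _ xa xb).
  by rewrite (first_diff_sep _ (dil2_first_diff xa) xdb).
have symE a b k : agree k a b <-> agree k b a :> Prop.
  by split; apply: agree_sym.
have [<-|/first_diff_exists[i xu]] := pselect (x = u).
  have [<-//|/first_diff_exists[j xv]] := pselect (x = v).
  by rewrite symE [X in _ <-> X]symE; apply: sep xv _ _; rewrite ?d2_fix.
have [<-|/first_diff_exists[j xv]] := pselect (x = v).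
  by apply: sep xu _ _; rewrite ?d2_fix.
case: (ltngtP i j) => [ij|ji|ij].
- by apply: sep xu _ _; [apply: agree_le xv.1|apply: agree_le (fd _ _ xv)].
- rewrite symE [X in _ <-> X]symE.
  by apply: sep xv _ _; [apply: agree_le xu.1|apply: agree_le (fd _ _ xu)].
- rewrite -{}ij in xv; rewrite (d2E xu) (d2E xv).
  rewrite {1}(first_diffE xu) {1}(first_diffE xv) !agree_catw.
  by rewrite !size_rcons !size_prefw subSS isom_agree.
Qed.

Lemma dil2_onto x v : agree 1 x v -> exists u, d2 x u = v.
Proof.
have [<- _|/first_diff_exists[[|n] xv xv1]] := pselect (x = v).
- by exists x.
- by case: xv => _; rewrite -xv1//; case: (x _).
have [V VK WK] := isom_bij (W (posS n) x).
exists (catw (rcons (prefw n x) (~~ x n)) (V (tailw n.+2 v))).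
rewrite (d2E (first_diff_catw _ _ _)).
by rewrite tailw_prefw WK -first_diffE.
Qed.

Lemma iter_dil2_fix p x : iter p (d2 x) x = x.
Proof. by elim: p => //= p ->. Qed.

Lemma iter_dil2_agree p x n u v :
  agree n u v <-> agree (p + n) (iter p (d2 x) u) (iter p (d2 x) v).
Proof. by elim: p => //= p ->; rewrite addSn -dil2_half. Qed.

Lemma iter_dil2_inj p x : injective (iter p (d2 x)).
Proof.
by move=> u v uv; apply: agree_all => n; apply/(iter_dil2_agree p x _ _ _).2 => k; rewrite uv.
Qed.

Lemma iter_dil2_sub p x u : agree p x (iter p (d2 x) u).
Proof.
have := (iter_dil2_agree p x 0 x u).1 (agree0 _ _).
by rewrite addn0 iter_dil2_fix.
Qed.

Lemma iter_dil2_onto p x v : agree p x v -> exists u, iter p (d2 x) u = v.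
Proof.
elim: p v => [|p IH] v xv; first by exists v.
have [w wv] := dil2_onto (agree_le (ltn0Sn p) xv).
have /IH[u uw] : agree p x w by apply/(dil2_half x _ _ _).2; rewrite d2_fix wv.
by exists u; rewrite /= uw.
Qed.

Lemma iter_dil2_range p x : range (iter p (d2 x)) = [set y | agree p x y].
Proof.
apply/seteqP; split=> [_ [u _ <-]|y /iter_dil2_onto[u <-]].
  exact: iter_dil2_sub.
by exists u.
Qed.

Hypothesis Wsmooth : smooth W.

(** In the second variable [d2] is a contraction. In the first variable, close
    to the diagonal both values are close to the base point; off the diagonal,
    base points with a long common prefix determine the same prefix of the
    value, and smoothness compares what follows it. *)
Lemma dil2_jointly_continuous : jointly_continuous d2.
Proof.
suff left x y n : exists m, forall x', agree m x x' ->
    agree n (d2 x y) (d2 x' y).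
  move=> x y n; have [m H] := left x y n; exists (maxn m n) => x' y' xx' yy'.
  apply: agree_trans (H _ (agree_le (leq_maxl _ _) xx')) _.
  apply: (agree_le (leqnSn n)); apply: (dil2_half _ _ _ _).1.
  exact: agree_le (leq_maxr m n) yy'.
have [<-|/first_diff_exists[i xy]] := pselect (x = y).
  exists n => x' xx'; rewrite d2_fix.
  apply: (agree_trans xx'); apply: (agree_le (leqnSn n)); rewrite -{1}(d2_fix x').
  exact/(dil2_half _ _ _ _).1/agree_sym.
(* Smoothness weights the distance by 2^-(i.+1), the index being [i.+1]. *)
have [mu mu0 muP] := Wsmooth (pow2V_gt0 R (i.+1 + n)).
have [m mmu] := pow2V_small mu0.
exists (maxn m i.+2) => x' xx'.
have xi : agree i.+2 x x' := agree_le (leq_maxr _ _) xx'.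
have xi1 : agree i.+1 x x' := agree_le (leqnSn _) xi.
have x'y : first_diff i x' y.
  split; last by rewrite -xi1// xy.2.
  by apply: agree_trans (agree_sym (agree_le (leqnSn _) xi1)) xy.1.
have xmu : mdist x x' < mu.
  apply: le_lt_trans mmu; apply/mdist_leP; exact: agree_le (leq_maxl _ _) xx'.
rewrite (d2E xy) (d2E x'y) -(agree_prefw xi1) -xi//.
apply/agree_catw/(agree_le (leq_subr _ _))/mdist_leP.
have := muP _ _ xmu (tailw i.+1 y) (posS i) ((mdist_ltP _ _ _).2 xi).
by rewrite exprD invfM ler_pM2l// pow2V_gt0.
Qed.

Lemma iter_dil2_jointly_continuous p :
  jointly_continuous (fun x => iter p (d2 x)).
Proof.
elim: p => [x y n|p IH x y n]; first by exists n.
have [m H] := dil2_jointly_continuous x (iter p (d2 x) y) n.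
have [k K] := IH x y m.
exists (maxn m k) => x' y' xx' yy' /=; apply: H.
  exact: agree_le (leq_maxl _ _) xx'.
by apply: K; [apply: agree_le xx'|apply: agree_le yy']; apply: leq_maxr.
Qed.

(** Outside the image of the dilatation the inverse is extended by the base
    point. As the image is an open and closed ball, the extension is continuous
    everywhere. *)
Lemma dil2_inverse_exists : exists inv : nat -> Xw -> Xw -> Xw,
  (forall p x, cancel (iter p (d2 x)) (inv p x)) /\
  (forall p, jointly_continuous (inv p)).
Proof.
have ex (t : nat * Xw * Xw) : exists z,
    (agree t.1.1 t.1.2 t.2 -> iter t.1.1 (d2 t.1.2) z = t.2) /\
    (~ agree t.1.1 t.1.2 t.2 -> z = t.1.2).
  case: t => -[p x] y /=.
  have [xy|nxy] := pselect (agree p x y); last by exists x.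
  by have [u uy] := iter_dil2_onto xy; exists u.
have [f fP] := boolp.choice ex.
exists (fun p x y => f (p, x, y)); split=> [p x u|p x y n].
  apply: (@iter_dil2_inj p x).
  by rewrite (fP (p, x, iter p (d2 x) u)).1//=; apply: iter_dil2_sub.
have [/= fxy fxyN] := fP (p, x, y).
have [xy|nxy] := pselect (agree p x y).
  have [m H] := iter_dil2_jointly_continuous p x (f (p, x, y)) (p + n).
  exists (maxn m (p + n)) => x' y' xx' yy'.
  have {}xx' : agree m x x' /\ agree (p + n) x x'.
    by split; apply: agree_le xx'; rewrite ?leq_maxl ?leq_maxr.
  have {}yy' : agree m y y' /\ agree (p + n) y y'.
    by split; apply: agree_le yy'; rewrite ?leq_maxl ?leq_maxr.
  have [/= f'xy _] := fP (p, x', y').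
  apply/(iter_dil2_agree p x' _ _ _).2; rewrite f'xy; last first.
    apply: (agree_trans (agree_le (leq_addr _ _) (agree_sym xx'.2))).
    exact: agree_trans xy (agree_le (leq_addr _ _) yy'.2).
  apply: agree_trans yy'.2; have := H _ _ xx'.1 (@agree_refl _ _ _).
  by rewrite fxy// => /agree_sym.
exists (maxn p n) => x' y' xx' yy'.
have [/= _ f'xy] := fP (p, x', y').
rewrite fxyN// f'xy; first exact: agree_le (leq_maxr _ _) xx'.
move=> x'y'; apply: nxy; apply: (agree_trans (agree_le (leq_maxl _ _) xx')).
exact: agree_trans x'y' (agree_sym (agree_le (leq_maxl _ _) yy')).
Qed.

Lemma jointly_continuous_continuous (f : Xw -> Xw -> Xw) x :
  jointly_continuous f -> continuous (f x).
Proof.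
move=> fC y A /nbhs_agree[n nA]; have [m H] := fC x y n.
by apply/nbhs_agree; exists m => y' yy'; apply: nA; apply: H.
Qed.

(** [domV] and [domW] both have to be the ball of radius 2^-p, which is the image
    of the dilatation. *)
Lemma dilatation_of_isom : exists D : dil_data R,
  [/\ weak_dilatation_structure D, is_p0 D 0%N & induced_by D d2].
Proof.
have [inv [invK invC]] := dil2_inverse_exists.
pose dom p x : set Xw := [set y | agree p x y].
pose delta (p : int) :=
  match p with Posz n => fun x => iter n (d2 x) | Negz n => inv n.+1 end.
pose D : dil_data R := DilData delta dom dom (fun=> @mdist R Xw).
have deltaC p : jointly_continuous (delta p).
  by case: p => n; [apply: iter_dil2_jointly_continuous|apply: invC].
have scaleE p x u v :
    2 ^+ p * mdist (iter p (d2 x) u) (iter p (d2 x) v) = mdist u v.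
  by apply/mdist_scaleP => n; apply: iter_dil2_agree.
exists D; split; last 2 first.
- by split=> // p x u v _; apply: scaleE.
- split=> // -[//|p] x _; split; first exact/esym/(iter_dil2_range p.+1).
  by move=> u; apply: invK.
split.
- split.
  + by split=> [p x|p x _]; apply: open_agree.
  + move=> p x; split=> [|y /mdist_leP|].
    * split; first exact: jointly_continuous_continuous (deltaC p).
      exists (inv p x); first exact: invK.
      by apply: continuous_subspaceT; exact: jointly_continuous_continuous (invC p).
    * by move=> /iter_dil2_onto[u <-]; exists u.
    * by move=> _ [u _ <-]; apply: iter_dil2_sub.
  + move=> [//|p] x _; split=> [u v||u] //=; last exact: invK.
    rewrite !inE => /iter_dil2_onto[u' <-] /iter_dil2_onto[v' <-].
    by rewrite !invK => ->.
  + exists 1, 0%N; split=> // p x u v _ _ _ _ /=.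
    have := (iter_dil2_agree p x 0 u v).1 (agree0 _ _); by rewrite addn0.
- have delta_fix p x : delta p x x = x.
    case: p => p; first exact: iter_dil2_fix.
    by rewrite /= -{2}(iter_dil2_fix p.+1 x) invK.
  (* [E] is continuous on the whole space. The coefficient 0 is the only limit
     point of the space of coefficients; near it, a dilatation of coefficient
     2^q with q >= n maps everything to the ball of radius 2^-n around the base
     point. *)
  pose E (t : scale R * Xw * Xw) : Xw :=
    if t.1.1 is Some p then delta p t.1.2 t.2 else t.1.2.
  have EC : continuous E.
    move=> [[s x] y] A /nbhs_agree[n nA].
    have nearE (S : set (scale R)) m : nbhs s S ->
        (forall s' x' y', S s' -> agree m x x' -> agree m y y' ->
           agree n (E (s, x, y)) (E (s', x', y'))) ->
        nbhs (s, x, y) (E @^-1` A).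
      move=> nS H.
      exists ([set a : scale R * Xw | S a.1 /\ agree m x a.2],
              [set b : Xw | agree m y b]) => /=.
        split; last by apply/nbhs_agree; exists m.
        exists (S, [set b : Xw | agree m x b]) => //=.
        by split=> //; apply/nbhs_agree; exists m.
      by move=> [[s' x'] y'] /= [[Ss' xx'] yy']; apply/nA/H.
    case: s {nA} nearE => [p|] nearE.
      have [m H] := deltaC p x y n.
      by apply: (nearE _ m (nbhs_scale_Some R p)) => s' x' y' ->; apply: H.
    apply: (nearE _ n (nbhs_scale_None R n)) => -[[q|//]|] x' y' //= nq xx' _.
    apply: (agree_trans xx'); apply: agree_le nq _.
    exact: iter_dil2_sub.
  split=> //; exists E; split=> //; try exact: continuous_subspaceT.
  move=> x y A /nbhs_agree[n nA]; exists n => // p /= np; apply: nA.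
  exact: agree_le np (@iter_dil2_sub p x y).
- by move=> p r x u; rewrite /= iterD.
- split=> [e e0|x u v]; last exact: wdist_positivity.
  by exists 0%N => // p _ x u v /=; rewrite scaleE subrr normr0.
Qed.

End FromIsometries.

Theorem theorem5p6 (R : realType) :
  (forall D : dil_data R, weak_dilatation_structure D -> is_p0 D 0%N ->
     exists W : posn -> infword R -> isom R,
       smooth W /\ dil2_rel W (dil D 1%R))
  /\
  (forall W : posn -> infword R -> isom R, smooth W ->
     exists d2 : infword R -> infword R -> infword R,
       unique (is_dil2_of W) d2 /\
       exists D : dil_data R,
         [/\ weak_dilatation_structure D, is_p0 D 0%N & induced_by D d2]).
Proof.
split=> [D Dweak Dp0|W Wsmooth]; first exact: isom_of_dilatation Dweak Dp0.
have [d2 d2W] := dil2_exists W.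
exists d2; split; first by split=> // d2'; apply: dil2_unique.
exact: dilatation_of_isom d2W Wsmooth.
Qed.
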